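(* Let $F$ be a field in which $2$ is invertible, and let $(V,B)$ be a formed space over $F$. Then the Kingdon algebra $K(V,B)$ is graded by $\mathbb{Z}/2$.
   Context: Algebras over $F$ are not necessarily associative. A formed space $(V,B)$ over $F$ is a finite-dimensional $F$-vector space $V$ equipped with a symmetric bilinear form $B$. An algebra is alternative if $x(xy)=(xx)y$ and $y(xx)=(yx)x$ for all elements $x,y$. $\mathrm{Alt}[V]$ denotes the free (unital) alternative $F$-algebra over $V$: it is alternative, contains $V$ as a subspace and $F=F1$, and each linear map from $V$ to an alternative $F$-algebra extends uniquely to an $F$-algebra homomorphism on $\mathrm{Alt}[V]$. The Kingdon algebra over $(V,B)$ is the quotient $K(V,B)=\mathrm{Alt}[V]/I_B$, where $I_B$ is the two-sided ideal of $\mathrm{Alt}[V]$ generated by all elements $uv+vu-B(u,v)\cdot 1$ and $(uv)w-w(vu)$ with $u,v,w\in V$. An algebra $K$ is graded by $\mathbb{Z}/2$ if it is a direct sum $K=K_0\oplus K_1$ of subspaces with $K_rK_s\subseteq K_{r+s}$, indices taken modulo $2$. *)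

(* Defs.v *)
From HB Require Import structures.
From mathcomp Require Import all_boot all_algebra.
From mathcomp Require Import boolp.

Set Implicit Arguments.
Unset Strict Implicit.
Unset Printing Implicit Defensive.

Import GRing.Theory.
Local Open Scope ring_scope.
Local Open Scope quotient_scope.

Reserved Notation "x ** y" (at level 40, left associativity).

HB.mixin Record Lmodule_isNaAlg (F : fieldType) A & GRing.Lmodule F A := {
  na1 : A;
  namul : A -> A -> A;
  na1mul : left_id na1 namul;
  namul1 : right_id na1 namul;
  namulDl : left_distributive namul +%R;
  namulDr : right_distributive namul +%R;
  namulZl : forall (c : F) x y, namul (c *: x) y = c *: namul x y;
  namulZr : forall (c : F) x y, namul x (c *: y) = c *: namul x y
}.

(* Unital algebras that need not be associative; the zero algebra is allowed. *)
#[short(type="naAlgType")]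
HB.structure Definition NaAlg (F : fieldType) :=
  {A of Lmodule_isNaAlg F A & GRing.Lmodule F A}.

Notation "x ** y" := (namul x y) : ring_scope.
Arguments na1 {F s}.

Definition alternative (F : fieldType) (A : naAlgType F) : Prop :=
  (forall x y : A, x ** (x ** y) = (x ** x) ** y) /\
  (forall x y : A, y ** (x ** x) = (y ** x) ** x).

Definition na_morphism (F : fieldType) (A A' : naAlgType F) (f : A -> A') :=
  [/\ linear f, f na1 = na1 & {morph f : x y / x ** y}].

Section NaAlgTheory.
Variables (F : fieldType) (A : naAlgType F).
Implicit Types x y : A.

Lemma namul0 x : x ** 0 = 0.
Proof. by rewrite -[X in x ** X](scale0r 0) namulZr scale0r. Qed.

Lemma na0mul x : 0 ** x = 0.
Proof. by rewrite -[X in X ** x](scale0r 0) namulZl scale0r. Qed.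

Lemma namulN x y : x ** (- y) = - (x ** y).
Proof. by rewrite -scaleN1r namulZr scaleN1r. Qed.

Lemma naNmul x y : (- x) ** y = - (x ** y).
Proof. by rewrite -scaleN1r namulZl scaleN1r. Qed.

End NaAlgTheory.

Definition two_sided_ideal (F : fieldType) (A : naAlgType F) (I : A -> Prop) :=
  [/\ I 0, (forall (c : F) x y, I x -> I y -> I (c *: x + y)),
      (forall a x, I x -> I (a ** x)) & (forall a x, I x -> I (x ** a))].

Definition ideal_gen (F : fieldType) (A : naAlgType F) (S : A -> Prop) :
  {pred A} := fun x =>
  `[< forall I : A -> Prop,
        two_sided_ideal I -> (forall s, S s -> I s) -> I x >].

Section IdealGen.
Variables (F : fieldType) (A : naAlgType F) (S : A -> Prop).

Lemma ideal_gen_ideal : two_sided_ideal (fun x => x \in ideal_gen S).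
Proof.
split.
- by apply/asboolP => I [].
- move=> c x y /asboolP Ix /asboolP Iy; apply/asboolP => I idI SI.
  by case: (idI) => _ + _ _; apply; [exact: Ix | exact: Iy].
- move=> a x /asboolP Ix; apply/asboolP => I idI SI.
  by case: (idI) => _ _ + _; apply; exact: Ix.
- move=> a x /asboolP Ix; apply/asboolP => I idI SI.
  by case: (idI) => _ _ _; apply; exact: Ix.
Qed.

Lemma mem_ideal_gen s : S s -> s \in ideal_gen S.
Proof. by move=> Ss; apply/asboolP => I _; apply. Qed.

Lemma ideal_gen_min (I : A -> Prop) x : two_sided_ideal I ->
  (forall s, S s -> I s) -> x \in ideal_gen S -> I x.
Proof. by move=> idI SI /asboolP; apply. Qed.

Lemma ideal_gen_zmod_closed : zmod_closed (ideal_gen S).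
Proof.
have [I0 IL _ _] := ideal_gen_ideal; split=> // x y Ix Iy.
by rewrite addrC -scaleN1r IL.
Qed.

HB.instance Definition _ :=
  GRing.isZmodClosed.Build A (ideal_gen S) ideal_gen_zmod_closed.

End IdealGen.

(* The quotient algebra A / ideal_gen S; MathComp provides its additive group. *)
Definition naquot (F : fieldType) (A : naAlgType F) (S : A -> Prop) :=
  Quotient.quot (ideal_gen S).

Section NaQuot.
Variables (F : fieldType) (A : naAlgType F) (S : A -> Prop).
Local Notation Q := (naquot S).

HB.instance Definition _ := GRing.Zmodule.on Q.

Definition na_pi : A -> Q := \pi_(Quotient.quot (ideal_gen S)).

Lemma na_piP x y : (na_pi x = na_pi y) <-> (x - y \in ideal_gen S).
Proof. by rewrite Quotient.idealrBE; split=> /eqP. Qed.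

Lemma na_pi_surj (q : Q) : exists x, q = na_pi x.
Proof. by exists (repr q); rewrite /na_pi reprK. Qed.

Lemma na_piK (q : Q) : na_pi (repr q) = q.
Proof. exact: reprK. Qed.

Lemma na_piD x y : na_pi (x + y) = na_pi x + na_pi y.
Proof. by rewrite /na_pi Quotient.pi_add. Qed.

Definition naquot_scale (c : F) (q : Q) : Q := na_pi (c *: repr q).
Definition naquot_mul (p q : Q) : Q := na_pi (repr p ** repr q).

Lemma na_pi_scale c x : naquot_scale c (na_pi x) = na_pi (c *: x).
Proof.
apply/na_piP; rewrite -scalerBr -[_ *: _]addr0.
have [I0 IL _ _] := ideal_gen_ideal S; apply: IL => //.
by apply/na_piP; rewrite na_piK.
Qed.

Lemma na_pi_mul x y : naquot_mul (na_pi x) (na_pi y) = na_pi (x ** y).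
Proof.
apply/na_piP; set x' := repr _; set y' := repr _.
have -> : x' ** y' - x ** y = 1 *: (x' ** (y' - y)) + (x' - x) ** y.
  rewrite scale1r namulDr namulDl namulN naNmul addrA.
  by rewrite -(addrA (x' ** y')) addNr addr0.
have [I0 IL Il Ir] := ideal_gen_ideal S.
apply: IL; [apply: Il | apply: Ir]; by apply/na_piP; rewrite na_piK.
Qed.

Fact naquot_scaleA a b (q : Q) :
  naquot_scale a (naquot_scale b q) = naquot_scale (a * b) q.
Proof. by have [x ->] := na_pi_surj q; rewrite !na_pi_scale scalerA. Qed.

Fact naquot_scale1 : left_id 1 naquot_scale.
Proof. by move=> q; have [x ->] := na_pi_surj q; rewrite na_pi_scale scale1r. Qed.

Fact naquot_scaleDr : right_distributive naquot_scale +%R.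
Proof.
move=> c p q; have [x ->] := na_pi_surj p; have [y ->] := na_pi_surj q.
by rewrite -na_piD !na_pi_scale -na_piD scalerDr.
Qed.

Fact naquot_scaleDl (q : Q) : {morph naquot_scale^~ q : a b / a + b}.
Proof.
by move=> a b; have [x ->] := na_pi_surj q; rewrite !na_pi_scale -na_piD scalerDl.
Qed.

HB.instance Definition _ := GRing.Zmodule_isLmodule.Build F Q
  naquot_scaleA naquot_scale1 naquot_scaleDr naquot_scaleDl.

Lemma na_piZ c x : na_pi (c *: x) = c *: na_pi x.
Proof. by rewrite -na_pi_scale. Qed.

Fact naquot_1mul : left_id (na_pi na1) naquot_mul.
Proof. by move=> q; have [x ->] := na_pi_surj q; rewrite na_pi_mul na1mul. Qed.

Fact naquot_mul1 : right_id (na_pi na1) naquot_mul.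
Proof. by move=> q; have [x ->] := na_pi_surj q; rewrite na_pi_mul namul1. Qed.

Fact naquot_mulDl : left_distributive naquot_mul +%R.
Proof.
move=> p q r; have [x ->] := na_pi_surj p; have [y ->] := na_pi_surj q.
by have [z ->] := na_pi_surj r; rewrite -na_piD !na_pi_mul -na_piD namulDl.
Qed.

Fact naquot_mulDr : right_distributive naquot_mul +%R.
Proof.
move=> p q r; have [x ->] := na_pi_surj p; have [y ->] := na_pi_surj q.
by have [z ->] := na_pi_surj r; rewrite -na_piD !na_pi_mul -na_piD namulDr.
Qed.

Fact naquot_mulZl (c : F) (p q : Q) :
  naquot_mul (c *: p) q = c *: naquot_mul p q.
Proof.
have [x ->] := na_pi_surj p; have [y ->] := na_pi_surj q.
by rewrite -na_piZ !na_pi_mul -na_piZ namulZl.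
Qed.

Fact naquot_mulZr (c : F) (p q : Q) :
  naquot_mul p (c *: q) = c *: naquot_mul p q.
Proof.
have [x ->] := na_pi_surj p; have [y ->] := na_pi_surj q.
by rewrite -na_piZ !na_pi_mul -na_piZ namulZr.
Qed.

HB.instance Definition _ := Lmodule_isNaAlg.Build F Q
  naquot_1mul naquot_mul1 naquot_mulDl naquot_mulDr naquot_mulZl naquot_mulZr.

Lemma na_pi_morphism : na_morphism na_pi.
Proof.
split=> // [c x y|x y]; first by rewrite na_piD na_piZ.
by rewrite -na_pi_mul.
Qed.

End NaQuot.

Section FreeAlternative.
Variables (F : fieldType) (V : vectType F).

Inductive alt_term : Type :=
| AltVar of V
| AltOne
| AltZero
| AltOpp of alt_term
| AltAdd of alt_term & alt_term
| AltScale of F & alt_term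
| AltMul of alt_term & alt_term.

Local Notation "x + y" := (AltAdd x y).
Local Notation "x * y" := (AltMul x y).
Local Notation "c *: x" := (AltScale c x).

(* The least congruence for which the quotient is a unital alternative algebra
   and the insertion of V is linear. *)
Inductive alt_eq : alt_term -> alt_term -> Prop :=
| alt_refl x : alt_eq x x
| alt_sym x y : alt_eq x y -> alt_eq y x
| alt_trans x y z : alt_eq x y -> alt_eq y z -> alt_eq x z
| alt_congOpp x x' : alt_eq x x' -> alt_eq (AltOpp x) (AltOpp x')
| alt_congAdd x x' y y' : alt_eq x x' -> alt_eq y y' -> alt_eq (x + y) (x' + y')
| alt_congScale c x x' : alt_eq x x' -> alt_eq (c *: x) (c *: x')
| alt_congMul x x' y y' : alt_eq x x' -> alt_eq y y' -> alt_eq (x * y) (x' * y')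
| alt_addA x y z : alt_eq (x + (y + z)) (x + y + z)
| alt_addC x y : alt_eq (x + y) (y + x)
| alt_add0 x : alt_eq (AltZero + x) x
| alt_addN x : alt_eq (AltOpp x + x) AltZero
| alt_scaleA a b x : alt_eq (a *: (b *: x)) ((a * b)%R *: x)
| alt_scale1 x : alt_eq (1%R *: x) x
| alt_scaleDr c x y : alt_eq (c *: (x + y)) (c *: x + c *: y)
| alt_scaleDl a b x : alt_eq ((a + b)%R *: x) (a *: x + b *: x)
| alt_1mul x : alt_eq (AltOne * x) x
| alt_mul1 x : alt_eq (x * AltOne) x
| alt_mulDl x y z : alt_eq ((x + y) * z) (x * z + y * z)
| alt_mulDr x y z : alt_eq (x * (y + z)) (x * y + x * z)
| alt_mulZl c x y : alt_eq ((c *: x) * y) (c *: (x * y))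
| alt_mulZr c x y : alt_eq (x * (c *: y)) (c *: (x * y))
| alt_left x y : alt_eq (x * (x * y)) ((x * x) * y)
| alt_right x y : alt_eq (y * (x * x)) ((y * x) * x)
| alt_linear c u v :
    alt_eq (AltVar (c *: u + v)%R) (c *: AltVar u + AltVar v).

HB.instance Definition _ := gen_eqMixin alt_term.
HB.instance Definition _ := gen_choiceMixin alt_term.

Definition alt_eqb (x y : alt_term) : bool := `[< alt_eq x y >].

Fact alt_eqb_equiv : equiv_class_of alt_eqb.
Proof.
split=> [x|x y|y x z]; first by apply/asboolP; exact: alt_refl.
- by apply/idP/idP => /asboolP h; apply/asboolP; exact: alt_sym.
- move=> /asboolP h /asboolP h'; apply/asboolP; exact: alt_trans h h'.
Qed.

Canonical alt_eqb_equivRel := EquivRelPack alt_eqb_equiv.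
Canonical alt_eqb_encModRel := defaultEncModRel alt_eqb.

Definition Alt := {eq_quot alt_eqb}.

HB.instance Definition _ := Choice.on Alt.

Definition alt_pi : alt_term -> Alt := \pi_{eq_quot alt_eqb}.

Lemma alt_piP x y : alt_pi x = alt_pi y <-> alt_eq x y.
Proof.
split=> [/eqmodP /asboolP //|h]; apply/eqmodP; exact/asboolP.
Qed.

Lemma alt_piK (p : Alt) : alt_pi (repr p) = p.
Proof. exact: reprK. Qed.

Lemma alt_pi_surj (p : Alt) : exists x, p = alt_pi x.
Proof. by exists (repr p); rewrite alt_piK. Qed.

Lemma alt_repr x : alt_eq (repr (alt_pi x)) x.
Proof. by apply/alt_piP; rewrite alt_piK. Qed.

Definition alt_opp (p : Alt) := alt_pi (AltOpp (repr p)).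
Definition alt_add (p q : Alt) := alt_pi (repr p + repr q).
Definition alt_scale (c : F) (p : Alt) := alt_pi (c *: repr p).
Definition alt_mul (p q : Alt) := alt_pi (repr p * repr q).

Lemma alt_oppE x : alt_opp (alt_pi x) = alt_pi (AltOpp x).
Proof. apply/alt_piP/alt_congOpp/alt_repr. Qed.

Lemma alt_addE x y : alt_add (alt_pi x) (alt_pi y) = alt_pi (x + y).
Proof. apply/alt_piP/alt_congAdd; exact: alt_repr. Qed.

Lemma alt_scaleE c x : alt_scale c (alt_pi x) = alt_pi (c *: x).
Proof. apply/alt_piP/alt_congScale/alt_repr. Qed.

Lemma alt_mulE x y : alt_mul (alt_pi x) (alt_pi y) = alt_pi (x * y).
Proof. apply/alt_piP/alt_congMul; exact: alt_repr. Qed.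

Local Ltac alt_lift rule :=
  repeat (let p := fresh "p" in move=> p;
          match type of p with
          | Alt => let x := fresh "x" in have [x ->] := alt_pi_surj p
          | _ => idtac
          end);
  rewrite ?(alt_oppE, alt_addE, alt_scaleE, alt_mulE); apply/alt_piP;
  exact: rule.

Fact Alt_addA : associative alt_add.
Proof. alt_lift alt_addA. Qed.
Fact Alt_addC : commutative alt_add.
Proof. alt_lift alt_addC. Qed.
Fact Alt_add0 : left_id (alt_pi AltZero) alt_add.
Proof. alt_lift alt_add0. Qed.
Fact Alt_addN : left_inverse (alt_pi AltZero) alt_opp alt_add.
Proof. alt_lift alt_addN. Qed.

HB.instance Definition _ :=
  GRing.isZmodule.Build Alt Alt_addA Alt_addC Alt_add0 Alt_addN.

Fact Alt_scaleA : forall a b p, alt_scale a (alt_scale b p) = alt_scale (a * b)%R p.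
Proof. alt_lift alt_scaleA. Qed.
Fact Alt_scale1 : left_id 1%R alt_scale.
Proof. alt_lift alt_scale1. Qed.
Fact Alt_scaleDr : right_distributive alt_scale alt_add.
Proof. alt_lift alt_scaleDr. Qed.
Fact Alt_scaleDl :
  forall p a b, alt_scale (a + b)%R p = alt_add (alt_scale a p) (alt_scale b p).
Proof. alt_lift alt_scaleDl. Qed.

HB.instance Definition _ := GRing.Zmodule_isLmodule.Build F Alt
  Alt_scaleA Alt_scale1 Alt_scaleDr Alt_scaleDl.

Fact Alt_1mul : left_id (alt_pi AltOne) alt_mul.
Proof. alt_lift alt_1mul. Qed.
Fact Alt_mul1 : right_id (alt_pi AltOne) alt_mul.
Proof. alt_lift alt_mul1. Qed.
Fact Alt_mulDl : left_distributive alt_mul alt_add.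
Proof. alt_lift alt_mulDl. Qed.
Fact Alt_mulDr : right_distributive alt_mul alt_add.
Proof. alt_lift alt_mulDr. Qed.
Fact Alt_mulZl : forall c p q, alt_mul (alt_scale c p) q = alt_scale c (alt_mul p q).
Proof. alt_lift alt_mulZl. Qed.
Fact Alt_mulZr : forall c p q, alt_mul p (alt_scale c q) = alt_scale c (alt_mul p q).
Proof. alt_lift alt_mulZr. Qed.

HB.instance Definition _ := Lmodule_isNaAlg.Build F Alt
  Alt_1mul Alt_mul1 Alt_mulDl Alt_mulDr Alt_mulZl Alt_mulZr.

Definition alt_in (v : V) : Alt := alt_pi (AltVar v).

Lemma alt_in_linear : linear alt_in.
Proof.
move=> c u v; rewrite [LHS](_ : _ = alt_add (alt_scale c (alt_in u)) (alt_in v)) //.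
by rewrite alt_scaleE alt_addE; apply/alt_piP/alt_linear.
Qed.

Lemma Alt_alternative : alternative Alt.
Proof.
split=> p q; have [x ->] := alt_pi_surj p; have [y ->] := alt_pi_surj q.
  rewrite [LHS](_ : _ = alt_mul (alt_pi x) (alt_mul (alt_pi x) (alt_pi y))) //.
  by rewrite !alt_mulE; transitivity (alt_mul (alt_mul (alt_pi x) (alt_pi x))
    (alt_pi y)); [rewrite !alt_mulE; apply/alt_piP/alt_left | ].
rewrite [LHS](_ : _ = alt_mul (alt_pi y) (alt_mul (alt_pi x) (alt_pi x))) //.
by rewrite !alt_mulE; transitivity (alt_mul (alt_mul (alt_pi y) (alt_pi x))
  (alt_pi x)); [rewrite !alt_mulE; apply/alt_piP/alt_right | ].
Qed.

Section Universal.
Variables (A : naAlgType F) (altA : alternative A).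
Variables (f : V -> A) (linf : linear f).

Fixpoint alt_eval (x : alt_term) : A :=
  match x with
  | AltVar v => f v
  | AltOne => na1
  | AltZero => 0
  | AltOpp x => - alt_eval x
  | AltAdd x y => (alt_eval x + alt_eval y)%R
  | AltScale c x => (c *: alt_eval x)%R
  | AltMul x y => alt_eval x ** alt_eval y
  end.

Lemma alt_eval_eq x y : alt_eq x y -> alt_eval x = alt_eval y.
Proof.
elim=> //=.
- by move=> ? ? ? _ -> _ ->.
- by move=> ? ? _ ->.
- by move=> ? ? ? ? _ -> _ ->.
- by move=> ? ? ? _ ->.
- by move=> ? ? ? ? _ -> _ ->.
- by move=> *; rewrite addrA.
- by move=> *; rewrite addrC.
- by move=> *; rewrite add0r.
- by move=> *; rewrite addNr.
- by move=> *; rewrite scalerA.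
- by move=> *; rewrite scale1r.
- by move=> *; rewrite scalerDr.
- by move=> *; rewrite scalerDl.
- by move=> *; rewrite na1mul.
- by move=> *; rewrite namul1.
- by move=> *; rewrite namulDl.
- by move=> *; rewrite namulDr.
- by move=> *; rewrite namulZl.
- by move=> *; rewrite namulZr.
- by move=> *; rewrite altA.1.
- by move=> *; rewrite altA.2.
Qed.

Definition alt_lift (p : Alt) : A := alt_eval (repr p).

Lemma alt_lift_pi x : alt_lift (alt_pi x) = alt_eval x.
Proof. exact/alt_eval_eq/alt_repr. Qed.

Lemma alt_lift_in v : alt_lift (alt_in v) = f v.
Proof. exact: alt_lift_pi. Qed.

Lemma alt_lift_morphism : na_morphism alt_lift.
Proof.
split=> [c p q||p q]; last 2 first.
- exact: alt_lift_pi.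
- have [x ->] := alt_pi_surj p; have [y ->] := alt_pi_surj q.
  rewrite [in LHS](_ : _ ** _ = alt_mul (alt_pi x) (alt_pi y)) //.
  by rewrite alt_mulE !alt_lift_pi.
have [x ->] := alt_pi_surj p; have [y ->] := alt_pi_surj q.
rewrite [in LHS](_ : (_ *: _ + _)%R =
  alt_add (alt_scale c (alt_pi x)) (alt_pi y)) //.
by rewrite alt_scaleE alt_addE !alt_lift_pi.
Qed.

Lemma alt_lift_uniq (g : Alt -> A) :
  na_morphism g -> (forall v, g (alt_in v) = f v) -> g =1 alt_lift.
Proof.
case=> ling g1 gM gf p; have [x ->] := alt_pi_surj p; rewrite alt_lift_pi.
have gD p1 q1 : g (p1 + q1)%R = (g p1 + g q1)%R.
  by have := ling 1%R p1 q1; rewrite !scale1r.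
have g0 : g 0%R = 0%R.
  by apply: (addIr (g 0%R)); rewrite -gD !add0r.
have gZ c p1 : g (c *: p1)%R = (c *: g p1)%R.
  by have := ling c p1 0%R; rewrite g0 !addr0.
elim: x => [v|||x IHx|x IHx y IHy|c x IHx|x IHx y IHy] /=.
- exact: gf.
- exact: g1.
- exact: g0.
- rewrite -IHx -scaleN1r -gZ scaleN1r; congr g.
  by rewrite -alt_oppE.
- by rewrite -IHx -IHy -gD; congr g; rewrite -alt_addE.
- by rewrite -IHx -gZ; congr g; rewrite -alt_scaleE.
- by rewrite -IHx -IHy -gM; congr g; rewrite -alt_mulE.
Qed.

End Universal.

Lemma Alt_universal (A : naAlgType F) (f : V -> A) :
  alternative A -> linear f ->
  exists! g : Alt -> A, na_morphism g /\ forall v, g (alt_in v) = f v.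
Proof.
move=> altA linf; exists (alt_lift f); split.
  by split; [exact: alt_lift_morphism | move=> v; exact: alt_lift_in].
by move=> g [hg gf]; apply/funext => p; rewrite (alt_lift_uniq altA linf hg gf).
Qed.

End FreeAlternative.

Arguments alt_in {F V} v.

(* F (+) V with V * V = 0 is alternative; evaluating in it shows that F and V
   embed in Alt[V]. *)
Section Embedding.
Variables (F : fieldType) (V : vectType F).

Definition dual_alg : Type := (F^o * V)%type.
HB.instance Definition _ := GRing.Lmodule.on dual_alg.

Definition dual_one : dual_alg := (1, 0).
Definition dual_mul (x y : dual_alg) : dual_alg :=
  (x.1 * y.1, (x.1 : F) *: y.2 + (y.1 : F) *: x.2).

Fact dual_1mul : left_id dual_one dual_mul.
Proof. by case=> a u; rewrite /dual_mul /= mul1r scale1r scaler0 addr0. Qed.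
Fact dual_mul1 : right_id dual_one dual_mul.
Proof. by case=> a u; rewrite /dual_mul /= mulr1 scale1r scaler0 add0r. Qed.
Fact dual_mulC x y : dual_mul x y = dual_mul y x.
Proof. by rewrite /dual_mul mulrC addrC. Qed.
Fact dual_mulDl : left_distributive dual_mul +%R.
Proof.
move=> [a u] [b v] [c w]; congr pair => /=; first by rewrite mulrDl.
by rewrite scalerDl scalerDr addrACA.
Qed.
Fact dual_mulDr : right_distributive dual_mul +%R.
Proof. by move=> x y z; rewrite dual_mulC dual_mulDl !(dual_mulC x). Qed.
Fact dual_mulZl (c : F) x y : dual_mul (c *: x) y = c *: dual_mul x y.
Proof.
case: x y => [a u] [b v]; congr pair => /=; first by rewrite -scalerAl.
by rewrite scalerDr !scalerA (mulrC b).
Qed.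
Fact dual_mulZr (c : F) x y : dual_mul x (c *: y) = c *: dual_mul x y.
Proof. by rewrite dual_mulC dual_mulZl dual_mulC. Qed.

HB.instance Definition _ := Lmodule_isNaAlg.Build F dual_alg
  dual_1mul dual_mul1 dual_mulDl dual_mulDr dual_mulZl dual_mulZr.

Lemma dual_alternative : alternative dual_alg.
Proof.
have altl (x y : dual_alg) : x ** (x ** y) = (x ** x) ** y.
  case: x y => [a u] [b v]; congr pair => /=; first by rewrite mulrA.
  by rewrite !scalerDr !scalerA -addrA (mulrC b).
split=> // x y.
have mulC (a b : dual_alg) : a ** b = b ** a by exact: dual_mulC.
by rewrite mulC -altl (mulC x y) mulC.
Qed.

Lemma Alt_embedding (a b : F) (u v : V) :
  a *: na1 + alt_in u = b *: na1 + alt_in v :> Alt V -> a = b /\ u = v.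
Proof.
pose f (w : V) : dual_alg := (0, w).
have linf : linear f.
  by move=> c w w'; congr pair; rewrite /= scaler0 addr0.
have [ling g1 _] := alt_lift_morphism dual_alternative linf.
move=> /(congr1 (alt_lift f)); rewrite !ling g1.
rewrite !(alt_lift_in dual_alternative linf) => -[].
by rewrite !scaler0 !add0r !addr0 /GRing.scale /= !mulr1.
Qed.

End Embedding.

(* {symmetric V} bundles bilinearity over F with B u v = B v u. *)
Section Kingdon.
Variables (F : fieldType) (V : vectType F) (B : {symmetric V}).

Inductive kingdon_rel : Alt V -> Prop :=
| kingdon_clifford (u v : V) :
    kingdon_rel (alt_in u ** alt_in v + alt_in v ** alt_in u - B u v *: na1)
| kingdon_reverse (u v w : V) :
    kingdon_rel ((alt_in u ** alt_in v) ** alt_in w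
                 - alt_in w ** (alt_in v ** alt_in u)).

Definition kingdon := naquot kingdon_rel.

HB.instance Definition _ := NaAlg.on kingdon.

Definition kingdon_in (v : V) : kingdon := na_pi kingdon_rel (alt_in v).

End Kingdon.

Definition Z2_grading (F : fieldType) (A : naAlgType F)
  (A_ : 'Z_2 -> {pred A}) : Prop :=
  [/\ forall r, submod_closed (A_ r),
      forall x : A, exists! p : A * A,
        [/\ p.1 \in A_ 0, p.2 \in A_ 1 & x = p.1 + p.2] &
      forall r s x y, x \in A_ r -> y \in A_ s -> x ** y \in A_ (r + s)].

(* Main.v *)
Require Import Defs.
From mathcomp Require Import all_boot all_algebra.
Import GRing.Theory.
Local Open Scope ring_scope.
Set Implicit Arguments.
Unset Strict Implicit.

(** The map [v |-> - v] of [V] extends to an involutive automorphism of [Alt V].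
    It fixes the Clifford relators and negates the reversal relators, so it
    descends to an involutive automorphism of the Kingdon algebra. As 2 is
    invertible, the algebra is the direct sum of its eigenspaces for the
    eigenvalues 1 and -1, and these multiply as a grading by Z/2. *)

Section Morphism.
Variables (F : fieldType) (A A' A'' : naAlgType F).

Section Properties.
Variables (f : A -> A') (hf : na_morphism f).

Lemma na_morphD x y : f (x + y) = f x + f y.
Proof. by case: hf => lin _ _; have := lin 1 x y; rewrite !scale1r. Qed.

Lemma na_morph0 : f 0 = 0.
Proof. by apply: (addIr (f 0)); rewrite -na_morphD !add0r. Qed.

Lemma na_morphZ (c : F) x : f (c *: x) = c *: f x.
Proof. by case: hf => lin _ _; have := lin c x 0; rewrite na_morph0 !addr0. Qed.

Lemma na_morphN x : f (- x) = - f x.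
Proof. by rewrite -scaleN1r na_morphZ scaleN1r. Qed.

Lemma na_morphB x y : f (x - y) = f x - f y.
Proof. by rewrite na_morphD na_morphN. Qed.

End Properties.

Lemma na_morph_comp (f : A -> A') (g : A' -> A'') :
  na_morphism f -> na_morphism g -> na_morphism (g \o f).
Proof.
case=> linf f1 fM [ling g1 gM]; split=> [c x y||x y] /=.
- by rewrite linf ling.
- by rewrite f1 g1.
- by rewrite fM gM.
Qed.

Lemma na_morph_id : na_morphism (@id A).
Proof. by []. Qed.

End Morphism.

Section QuotientMorphism.
Variables (F : fieldType) (A : naAlgType F) (S : A -> Prop) (f : A -> A).
Hypotheses (hf : na_morphism f) (fS : forall s, S s -> f s \in ideal_gen S).

(** The preimage under [f] of the ideal generated by [S] is again a two-sided ideal and contains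
    [S], so minimality applies. *)
Lemma ideal_gen_morph x : x \in ideal_gen S -> f x \in ideal_gen S.
Proof.
have [I0 IL Il Ir] := ideal_gen_ideal S; have [lin _ fM] := hf.
apply: (@ideal_gen_min _ _ _ (fun x => f x \in ideal_gen S)) => //.
split=> [|c y z Iy Iz|a y Iy|a y Iy].
- by rewrite na_morph0.
- by rewrite lin; apply: IL.
- by rewrite fM; apply: Il.
- by rewrite fM; apply: Ir.
Qed.

Definition naquot_map (q : naquot S) : naquot S := na_pi S (f (repr q)).

(** Independence of the representative: [repr (na_pi S x)] differs from [x] by an element of the
    ideal, and [f] preserves the ideal. *)
Lemma naquot_map_pi x : naquot_map (na_pi S x) = na_pi S (f x).
Proof.
apply/na_piP; rewrite -na_morphB //; apply: ideal_gen_morph.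
by apply/na_piP; rewrite na_piK.
Qed.

Lemma naquot_map_morphism : na_morphism naquot_map.
Proof.
have [linpi pi1 piM] := na_pi_morphism S; have [lin f1 fM] := hf.
split=> [c p q||p q].
- have [x ->] := na_pi_surj p; have [y ->] := na_pi_surj q.
  by rewrite -linpi !naquot_map_pi lin linpi.
- by rewrite -pi1 naquot_map_pi f1.
- have [x ->] := na_pi_surj p; have [y ->] := na_pi_surj q.
  by rewrite -piM !naquot_map_pi fM piM.
Qed.

End QuotientMorphism.

Section Eigengrading.
Variables (F : fieldType) (A : naAlgType F) (f : A -> A).

Definition eigengrading (r : 'Z_2) : {pred A} := fun x => f x == (-1) ^+ r *: x.

Lemma eigengradingP : (2%:R : F) \is a GRing.unit -> na_morphism f ->
  involutive f -> Z2_grading eigengrading.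
Proof.
move=> u2 hf fK; have [lin _ fM] := hf.
have half (x : A) : 2%:R^-1 *: (x + x) = x.
  by rewrite -mulr2n -scaler_nat scalerA mulVr // scale1r.
split=> [r|x|r s x y].
- split=> [|c x y]; first by rewrite unfold_in na_morph0 // scaler0.
  rewrite !unfold_in => /eqP fx /eqP fy.
  by rewrite lin fx fy scalerDr !scalerA mulrC.
(* The witness is forced: if [x = a + b] with [a] fixed and [b] negated by [f], then [f x = a - b],
   so [a] and [b] are the half sum and half difference of [x] and [f x]. *)
- exists (2%:R^-1 *: (x + f x), 2%:R^-1 *: (x - f x)); split=> /=.
    rewrite !unfold_in /= expr0 expr1 scale1r scaleN1r -scalerN opprB.
    rewrite !(na_morphZ hf) (na_morphB hf) (na_morphD hf) fK addrC.
    rewrite (addrC (f x)) -scalerDr addrACA addrN.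
    by rewrite addr0 half.
  case=> a b [/=]; rewrite !unfold_in /= expr0 expr1 scale1r scaleN1r.
  move=> /eqP fa /eqP fb ->; rewrite (na_morphD hf) fa fb opprB.
  by rewrite addrACA addrN addr0 half (addrC a) addrACA addrN addr0 half.
- rewrite !unfold_in => /eqP fx /eqP fy.
  rewrite fM fx fy namulZl namulZr scalerA -exprD.
  (* The sum in ['Z_2] is the sum of the exponents reduced modulo 2, and a power of -1 depends only
     on the parity of its exponent. *)
  by rewrite /= modn2 signr_odd.
Qed.

End Eigengrading.

Section AltParity.
Variables (F : fieldType) (V : vectType F).

Definition alt_parity : Alt V -> Alt V := alt_lift (fun v => - alt_in v).

Lemma alt_inN_linear : linear (fun v : V => - alt_in v).
Proof. by move=> c u v; rewrite alt_in_linear opprD scalerN. Qed.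

Lemma alt_parity_morphism : na_morphism alt_parity.
Proof. exact (alt_lift_morphism (@Alt_alternative F V) alt_inN_linear). Qed.

Lemma alt_parity_in v : alt_parity (alt_in v) = - alt_in v.
Proof. exact (alt_lift_in (@Alt_alternative F V) alt_inN_linear v). Qed.

(** The square of [alt_parity] and the identity are both morphisms extending [alt_in], so the
    uniqueness in the universal property identifies them. *)
Lemma alt_parityK : involutive alt_parity.
Proof.
move=> p; have hp := alt_parity_morphism.
have uniq := alt_lift_uniq (@Alt_alternative F V) (@alt_in_linear F V).
rewrite [RHS](uniq _ (@na_morph_id _ _) (fun=> erefl) p).
apply: (uniq _ (na_morph_comp hp hp)) => v /=.
by rewrite alt_parity_in na_morphN // alt_parity_in opprK.
Qed.

Lemma alt_parity_kingdon_rel (B : {symmetric V}) s :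
  kingdon_rel B s -> alt_parity s \in ideal_gen (kingdon_rel B).
Proof.
have hp := alt_parity_morphism; have [_ p1 pM] := hp.
case=> [u v|u v w].
  rewrite na_morphB // na_morphD // na_morphZ // p1 !pM !alt_parity_in.
  (* The two signs in each quadratic product cancel. *)
  rewrite !naNmul !namulN !opprK.
  exact/mem_ideal_gen/kingdon_clifford.
rewrite na_morphB // !pM !alt_parity_in !(naNmul, namulN) !opprK.
(* Each cubic product keeps one sign, which leaves the opposite of a relator. *)
rewrite addrC -opprB rpredN.
exact/mem_ideal_gen/kingdon_reverse.
Qed.

End AltParity.

Theorem proposition3p2 (F : fieldType) (two_unit : (2%:R : F) \is a GRing.unit)
    (V : vectType F) (B : {symmetric V}) :
  exists K_ : 'Z_2 -> {pred kingdon B},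
    Z2_grading K_ /\ forall v : V, kingdon_in B v \in K_ 1.
Proof.
have hp := @alt_parity_morphism F V.
have prel := @alt_parity_kingdon_rel F V B.
have mapE := naquot_map_pi hp prel.
exists (@eigengrading F (kingdon B)
  (@naquot_map F _ (kingdon_rel B) (@alt_parity F V))).
split=> [|v].
  apply: eigengradingP => //; first exact: naquot_map_morphism.
  by move=> q; have [x ->] := na_pi_surj q; rewrite !mapE alt_parityK.
(* Generators are odd: the sign appears already in [Alt V], and the projection commutes with
   negation. *)
rewrite unfold_in /kingdon_in mapE alt_parity_in expr1 scaleN1r.
by rewrite na_morphN //; apply: na_pi_morphism.
Qed.
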